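(* Let $G$ be a hyperbolic group. Then the canonical action $G\curvearrowright \partial G$ of $G$ on its Gromov boundary has the shadowing (pseudo-orbit tracing property).
   Context: Hyperbolic group: a finitely generated group $G$ which is hyperbolic with respect to the word metric $d_S$ of some (equivalently, any) finite symmetric generating set $S$, where $d_S(g,h)=\min\{n : \exists s_1,\dots,s_n\in S,\ g=hs_1\cdots s_n\}$ for $g\ne h$ (and $d_S(g,g)=0$). Hyperbolic means: there is $\delta\ge 0$ such that for every geodesic triangle, each side is contained in the $\delta$-neighbourhood of the union of the other two sides (Rips hyperbolicity). Gromov boundary: a geodesic ray is an isometric embedding $c:\mathbb{N}\to (G,d_S)$. Two geodesic rays are asymptotic if their images have finite Hausdorff distance. $\partial G$ is the set of geodesic rays modulo the relation of being asymptotic, with the quotient topology of the topology of uniform convergence on bounded subsets on the set of geodesic rays. It is a compact metrizable space which does not depend on $S$ up to canonical homeomorphism. The canonical action of $G$ on $\partial G$ is the continuous action induced by left multiplication, $g[c]=[g c]$, where $(gc)(t)=g\cdot c(t)$. Shadowing: a continuous action of a countable group $G$ on a compact Hausdorff space $X$ has the shadowing (pseudo-orbit tracing property) if for every finite open cover $(U_i)_{i=1}^n$ of $X$ there exist a finite open cover $(V_j)_{j=1}^m$ of $X$ and a finite set $F\subseteq G$ such that for every family $(x_g)_{g\in G}\subseteq X$ with the property that for all $g\in G$ and $s\in F$ there is $j\le m$ with $s x_g, x_{sg}\in V_j$, there exists $x\in X$ such that for every $g\in G$ there is $i\le n$ with $gx, x_g\in U_i$. *)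

(* Defs.v *)
From HB Require Import structures.
From mathcomp Require Import all_boot all_order all_algebra generic_quotient.
From mathcomp Require Import finmap all_classical topology.

Set Implicit Arguments.
Unset Strict Implicit.
Unset Printing Implicit Defensive.

Local Open Scope classical_set_scope.
Local Open Scope quotient_scope.
Local Open Scope group_scope.

Record sym_generating_set (G : groupType) := SymGeneratingSet {
  generators :> {fset G};
  generators_sym : forall s, s \in generators -> s^-1 \in generators;
  generators_gen : forall g, exists2 w : seq G,
    {subset w <= generators} & g = \prod_(s <- w) s }.

Section WordMetric.
Variables (G : groupType) (S : sym_generating_set G).
Implicit Types (g h k : G) (n : nat).

Definition word_path g h : pred nat :=
  fun n => `[< exists2 w : n.-tuple G,
                 {subset w <= generators S} & g = h * \prod_(s <- w) s >].

Lemma word_pathP g h n :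
  reflect (exists w : seq G,
             [/\ size w = n, {subset w <= generators S}
               & g = h * \prod_(s <- w) s])
          (word_path g h n).
Proof.
apply: (iffP (asboolP _)) => [[w wS ->]|[w [sw wS ->]]].
  by exists w; rewrite size_tuple.
by move/eqP: sw => sw; exists (Tuple sw).
Qed.

Lemma word_path_ex g h : exists n, word_path g h n.
Proof.
have [w wS gE] := generators_gen S (h^-1 * g).
by exists (size w); apply/word_pathP; exists w; rewrite -gE mulVKg.
Qed.

(* The empty word is allowed, so that [word_dist g g = 0]. *)
Definition word_dist g h : nat := ex_minn (word_path_ex g h).

Lemma word_dist_path g h : word_path g h (word_dist g h).
Proof. by rewrite /word_dist; case: ex_minnP. Qed.

Lemma word_dist_min g h n : word_path g h n -> (word_dist g h <= n)%N.
Proof. by rewrite /word_dist; case: ex_minnP => m _; apply. Qed.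

Lemma word_dist_eq0 g h : (word_dist g h == 0%N) = (g == h).
Proof.
apply/eqP/eqP => [d0|->].
  have := word_dist_path g h; rewrite d0 => /word_pathP[w [/size0nil-> _ ->]].
  by rewrite big_nil mulg1.
apply/eqP; rewrite -leqn0; apply: word_dist_min.
by apply/word_pathP; exists [::]; rewrite big_nil mulg1.
Qed.

Lemma word_dist_sym g h : word_dist g h = word_dist h g.
Proof.
suff le a b : (word_dist a b <= word_dist b a)%N.
  by apply/eqP; rewrite eqn_leq !le.
apply: word_dist_min; have /word_pathP[w [sw wS bE]] := word_dist_path b a.
apply/word_pathP; exists [seq s^-1 | s <- rev w]; split.
- by rewrite size_map size_rev.
- by move=> s /mapP[t]; rewrite mem_rev => /wS tS ->; apply: generators_sym.
- by rewrite big_map prodgV revK {1}bE mulgK.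
Qed.

Lemma word_dist_triangle g h k :
  (word_dist g k <= word_dist g h + word_dist h k)%N.
Proof.
have /word_pathP[v [sv vS gE]] := word_dist_path g h.
have /word_pathP[w [sw wS hE]] := word_dist_path h k.
apply: word_dist_min; apply/word_pathP; exists (w ++ v); split.
- by rewrite size_cat sv sw addnC.
- by move=> s; rewrite mem_cat => /orP[/wS|/vS].
- by rewrite big_cat /= mulgA -hE.
Qed.

Lemma word_distM k g h : word_dist (k * g) (k * h) = word_dist g h.
Proof.
suff le c a b : (word_dist (c * a) (c * b) <= word_dist a b)%N.
  apply/eqP; rewrite eqn_leq le /=.
  by rewrite -{1}(mulKg k g) -{1}(mulKg k h) le.
apply: word_dist_min; have /word_pathP[w [sw wS aE]] := word_dist_path a b.
by apply/word_pathP; exists w; split; rewrite // {1}aE mulgA.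
Qed.

Definition neighbourhood (r : nat) (A : set G) : set G :=
  [set g | exists2 h, A h & (word_dist g h <= r)%N].

Definition geodesic (g h : G) (n : nat) (c : nat -> G) : Prop :=
  [/\ c 0%N = g, c n = h &
      forall i j, (i <= n)%N -> (j <= n)%N ->
        word_dist (c i) (c j) = `|i - j|%N].

Definition geodesic_side (g h : G) (A : set G) : Prop :=
  exists n c, geodesic g h n c /\ A = c @` [set i | (i <= n)%N].

(* Distances are natural numbers, so a natural [delta] loses nothing. *)
Definition hyperbolic : Prop :=
  exists delta : nat, forall (x y z : G) (A B C : set G),
    geodesic_side x y A -> geodesic_side y z B -> geodesic_side z x C ->
    [/\ A `<=` neighbourhood delta (B `|` C),
        B `<=` neighbourhood delta (C `|` A) &
        C `<=` neighbourhood delta (A `|` B)].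

Definition geodesic_ray : set (nat -> G) :=
  [set c | forall i j : nat, word_dist (c i) (c j) = `|i - j|%N].

Definition bounded_nat (A : set nat) : Prop :=
  exists n, A `<=` [set i | (i <= n)%N].

(* Uniform convergence on bounded sets with respect to [word_dist]: by
   [word_dist_eq0] the balls of radius less than 1 are singletons, so the metric
   uniformity of [G] is the discrete one. *)
Definition ray_set : set {family bounded_nat, nat -> discrete_topology G} :=
  geodesic_ray.

Definition ray_space : topologicalType := ray_set.

Implicit Types c : ray_space.

Definition ray_fun c : nat -> G := \val c.

(* The images have finite Hausdorff distance. *)
Definition asymptotic c c' : Prop :=
  exists r : nat,
    range (ray_fun c) `<=` neighbourhood r (range (ray_fun c')) /\
    range (ray_fun c') `<=` neighbourhood r (range (ray_fun c)).

Lemma neighbourhood_trans r r' (A B C : set G) :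
  A `<=` neighbourhood r B -> B `<=` neighbourhood r' C ->
  A `<=` neighbourhood (r + r') C.
Proof.
move=> AB BC g /AB[h /BC[k Ck hk] gh]; exists k => //.
exact: leq_trans (word_dist_triangle g h k) (leq_add gh hk).
Qed.

Definition asymptoticb : rel ray_space := fun c c' => `[< asymptotic c c' >].

Lemma asymptoticb_refl : reflexive asymptoticb.
Proof.
move=> c; apply/asboolP; exists 0%N; split=> g cg; exists g => //;
by rewrite leqn0 word_dist_eq0.
Qed.

Lemma asymptoticb_sym : symmetric asymptoticb.
Proof. by move=> c c'; apply/asboolP/asboolP => -[r [? ?]]; exists r. Qed.

Lemma asymptoticb_trans : transitive asymptoticb.
Proof.
move=> c2 c1 c3 /asboolP[r [h12 h21]] /asboolP[r' [h23 h32]].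
apply/asboolP; exists (r + r')%N; split; first exact: neighbourhood_trans h23.
by rewrite addnC; exact: neighbourhood_trans h21.
Qed.

Canonical asymptotic_equiv :=
  EquivRel asymptoticb asymptoticb_refl asymptoticb_sym asymptoticb_trans.

Definition boundary : topologicalType :=
  quotient_topology {eq_quot asymptotic_equiv}.

Section RayTranslation.
Variable g : G.

Lemma ray_translate_subproof c :
  (fun t => g * ray_fun c t) \in ray_set.
Proof.
by apply/mem_set => i j /=; rewrite word_distM; exact: (set_mem (valP c)).
Qed.

Definition ray_translate c : ray_space :=
  exist (fun f => f \in ray_set) _ (ray_translate_subproof c).

Lemma ray_translate_continuous : continuous ray_translate.
Proof.
apply: continuous_comp_initial => c.
have vc : continuous (ray_fun : ray_space ->
    {family bounded_nat, nat -> discrete_topology G}).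
  exact: initial_continuous.
have fF : Filter ((set_val \o ray_translate) @ c).
  exact/fmap_filter/nbhs_filter.
apply/(fam_cvgP _ _ fF) => A bA P /uniform_nbhs[E [entE EP]].
have entD : entourage (range (fun x : discrete_topology G => (x, x))).
  by rewrite uniform_discrete.
change (nbhs c ((set_val \o ray_translate) @^-1` P)).
have /= cA := vc c _ (fam_nbhs _ entD bA).
apply: (@filterS _ _ (nbhs_filter c) _ _ _ cA) => c' cc'; apply: EP => t At.
have [x _ [e1 e2]] := cc' t At.
rewrite [X in E (X, _)](_ : _ = g * ray_fun c t)//.
rewrite [X in E (_, X)](_ : _ = g * ray_fun c' t)//.
by rewrite -e1 -e2; exact: entourage_refl.
Qed.

Lemma ray_translate_asymptotic c c' :
  asymptotic c c' -> asymptotic (ray_translate c) (ray_translate c').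
Proof.
suff le r a b : range (ray_fun a) `<=` neighbourhood r (range (ray_fun b)) ->
    range (ray_fun (ray_translate a)) `<=`
      neighbourhood r (range (ray_fun (ray_translate b))).
  by move=> [r [/le ? /le ?]]; exists r.
move=> ab _ [t _ <-]; have [|_ [u _ <-] tu] := ab (ray_fun a t); first by exists t.
by exists (g * ray_fun b u); [exists u | rewrite /ray_fun /= word_distM].
Qed.

End RayTranslation.

Definition ray_class (c : ray_space) : boundary := \pi_boundary c.

Definition boundary_translate g (xi : boundary) : boundary :=
  ray_class (ray_translate g (repr xi)).

Lemma ray_classP c c' : ray_class c = ray_class c' <-> asymptotic c c'.
Proof. by split=> [/eqmodP/asboolP|?]//; apply/eqmodP/asboolP. Qed.

Lemma ray_class_surj (xi : boundary) : exists c, xi = ray_class c.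
Proof. by exists (repr xi); rewrite /ray_class reprK. Qed.

Lemma boundary_translateE g c :
  boundary_translate g (ray_class c) = ray_class (ray_translate g c).
Proof.
apply/ray_classP/ray_translate_asymptotic/ray_classP.
by rewrite /ray_class reprK.
Qed.

End WordMetric.

Record continuous_action (G : groupType) (X : topologicalType) :=
  ContinuousAction {
    action_fun :> G -> X -> X;
    action1 : forall x, action_fun 1 x = x;
    actionM : forall g h x, action_fun (g * h) x = action_fun g (action_fun h x);
    action_continuous : forall g, continuous (action_fun g) }.

Section BoundaryAction.
Variables (G : groupType) (S : sym_generating_set G).

Lemma boundary_translate1 (xi : boundary S) : boundary_translate 1 xi = xi.
Proof.
have [c ->] := ray_class_surj xi; rewrite boundary_translateE; congr ray_class.
by apply/val_inj/funext => t; rewrite /= mul1g.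
Qed.

Lemma boundary_translateM g h (xi : boundary S) :
  boundary_translate (g * h) xi = boundary_translate g (boundary_translate h xi).
Proof.
have [c ->] := ray_class_surj xi; rewrite !boundary_translateE; congr ray_class.
by apply/val_inj/funext => t; rewrite /= /ray_fun /= mulgA.
Qed.

Lemma boundary_translate_continuous g :
  continuous (boundary_translate g : boundary S -> boundary S).
Proof.
apply/quotient_continuous.
rewrite (_ : _ \o _ = @ray_class G S \o ray_translate g); last first.
  by apply/funext => c; exact: boundary_translateE.
move=> c; apply: continuous_comp; first exact: ray_translate_continuous.
exact: pi_continuous.
Qed.

Definition boundary_action : continuous_action G (boundary S) :=
  ContinuousAction boundary_translate1 boundary_translateM
    boundary_translate_continuous.

End BoundaryAction.

Definition finite_open_cover (X : topologicalType) n (U : 'I_n -> set X) : Prop :=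
  (forall i, open (U i)) /\ cover setT U = setT.

Definition shadowing (G : groupType) (X : topologicalType)
    (a : continuous_action G X) : Prop :=
  forall n (U : 'I_n -> set X), finite_open_cover U ->
  exists m (V : 'I_m -> set X), finite_open_cover V /\
  exists F : {fset G}, forall x : G -> X,
    (forall g s, s \in F -> exists j, V j (a s (x g)) /\ V j (x (s * g))) ->
    exists y, forall g, exists i, U i (a g y) /\ U i (x g).

(* Main.v *)
Require Import Defs.
From HB Require Import structures.
From mathcomp Require Import all_boot all_order all_algebra.
From mathcomp Require Import finmap all_classical topology.
From mathcomp Require Import zify.

(** Fix the constant [E] of the four-point inequality for the word
metric. A pseudo-orbit [x] gives at each vertex [h] the boundary point
[h x_(h^-1)], hence a geodesic ray [r h] from [h]. In these terms the
pseudo-orbit condition says that [r h] and [r h'] are still close to each other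
at a large time [T] whenever [h] and [h'] are at distance at most [R], and the
goal is one boundary point which, seen from each [h], lies close to the end of
[r h].

Let [step h] be the point of [r h] at time [L], with [L] much larger than [E].
The rays at consecutive points of the sequence [iter n step h] are close at
time [T], so three consecutive points are nearly aligned, and in a hyperbolic
space such a broken geodesic is a quasi-geodesic ([dist_iterD]). The sequence
therefore converges to a boundary point that is close, seen from any of its
points, to the end of the ray chosen there, for a length of almost two steps
([gprod_iter_far]).

The limit does not depend on [h]. For neighbours [a] and [b] the two sequences
cannot diverge ([gprod_neighbours]): just before the place where they would
separate, each has a point less than one step away from it. These two points are
at distance at most about [2 L], hence their chosen rays have nearly the same
end; but each sequence follows the ray chosen at its own point for two steps,
that is beyond the supposed place of separation. A finite generating set
connects all vertices, so all sequences have the same limit, which is the end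
of one ray ([tracing_ray]).

Two compactness facts translate between covers of the boundary and distances
between rays from [1]: shadows of vertices form a finite open cover
([finite_shadow_cover]), which is the cover that a pseudo-orbit has to respect,
and every finite open cover has a Lebesgue number ([lebesgue_number]). Both come
from the compactness of the set of rays from [1] ([compact_sequences]). *)

Set Implicit Arguments.
Unset Strict Implicit.
Unset Printing Implicit Defensive.

Local Open Scope classical_set_scope.
Local Open Scope group_scope.

(** * The Gromov product *)
Section GromovProduct.
Variables (G : groupType) (S : sym_generating_set G).
Local Notation d := (word_dist S).
Implicit Types g h u v w x y z : G.

Lemma word_distxx x : d x x = 0%N.
Proof. by apply/eqP; rewrite word_dist_eq0. Qed.

(** Twice the Gromov product of [x] and [y] at [w], which avoids halves. The
subtraction never truncates, by the triangle inequality. *)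
Definition gprod w x y : nat := (d w x + d w y - d x y)%N.

Lemma gprodE w x y : (gprod w x y + d x y = d w x + d w y)%N.
Proof.
rewrite /gprod subnK//; have := word_dist_triangle S x w y.
by rewrite (word_dist_sym S x w).
Qed.

Lemma gprodM g w x y : gprod (g * w) (g * x) (g * y) = gprod w x y.
Proof. by rewrite /gprod !word_distM. Qed.

(** Gromov's form of hyperbolicity, for twice the product. *)
Definition four_point (E : nat) : Prop := forall w x y z,
  (minn (gprod w x y) (gprod w y z) <= gprod w x z + E)%N.

End GromovProduct.

Ltac pose_new t :=
  let T := type of t in
  match goal with
  | H : T |- _ => fail 1
  | _ => have ? := t
  end.

(** Linear arithmetic over distances. Distances are opaque to [lia], which is
given here the symmetry of each of them and the definition of each product;
triangle and four-point inequalities remain for the caller to choose. *)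
Ltac metric_lia :=
  repeat match goal with
  | |- context [gprod ?S ?w ?x ?y] => pose_new (gprodE S w x y)
  | H : context [gprod ?S ?w ?x ?y] |- _ => pose_new (gprodE S w x y)
  end;
  repeat match goal with
  | |- context [word_dist ?S ?x ?x] => pose_new (word_distxx S x)
  | H : context [word_dist ?S ?x ?x] |- _ => pose_new (word_distxx S x)
  | |- context [word_dist ?S ?x ?y] => pose_new (word_dist_sym S x y)
  | H : context [word_dist ?S ?x ?y] |- _ => pose_new (word_dist_sym S x y)
  end;
  lia.

(** * Geodesics and thin triangles *)
Section Geodesics.
Variables (G : groupType) (S : sym_generating_set G).
Local Notation d := (word_dist S).
Implicit Types g h u v w x y z : G.

Lemma geodesic_exists x y : exists c, geodesic S x y (d x y) c.
Proof.
have /word_pathP[w [sw wS yE]] := word_dist_path S y x.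
pose c i := x * \prod_(s <- take i w) s.
have cn : c (d x y) = y.
  by rewrite /c word_dist_sym -sw take_size -yE.
have le i j : (i <= j)%N -> (d (c j) (c i) <= j - i)%N.
  move=> ij; apply: leq_trans (_ : size (drop i (take j w)) <= _)%N.
    apply: word_dist_min; apply/word_pathP.
    exists (drop i (take j w)); split=> //.
      by move=> s /mem_drop/mem_take/wS.
    rewrite /c -mulgA; congr (_ * _).
    by rewrite -[in LHS](cat_take_drop i (take j w)) big_cat/= take_takel.
  by rewrite size_drop leq_sub2r// size_take; case: ltnP => // /ltnW.
exists c; split=> //; first by rewrite /c take0 big_nil mulg1.
suff eqd i j : (i <= j)%N -> (j <= d x y)%N -> d (c i) (c j) = (j - i)%N.
  move=> i j ilen jlen; case: (leqP i j) => ij; first by rewrite eqd//; lia.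
  by rewrite word_dist_sym eqd//; lia.
move=> ij jn; have := le _ _ ij; have := le _ _ (leq0n i); have := le _ _ jn.
have := word_dist_triangle S (c (d x y)) (c j) (c 0%N).
have := word_dist_triangle S (c j) (c i) (c 0%N).
have c0 : c 0%N = x by rewrite /c take0 big_nil mulg1.
rewrite cn c0; metric_lia.
Qed.

(** The last clause is the connectedness of a geodesic: covered by two sets, each
containing one end, it has two points at distance at most 1, one in each. *)
Lemma geodesic_side_exists x y : exists A : set G,
  [/\ geodesic_side S x y A,
      forall p, A p -> (d x p + d p y = d x y)%N,
      A x, A y &
      forall P Q : set G, A `<=` P `|` Q -> P x -> Q y ->
        exists p q, [/\ A p, A q, P p, Q q & (d p q <= 1)%N]].
Proof.
have [c [c0 cn cd]] := geodesic_exists x y.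
exists (c @` [set i | (i <= d x y)%N]); split.
- by exists (d x y), c.
- move=> _ [i /= ilen <-].
  have := cd 0%N i isT ilen; have := cd i _ ilen (leqnn _).
  by rewrite c0 cn; lia.
- by exists 0%N => /=.
- by exists (d x y) => /=.
move=> P Q cover Px Qy.
have cP i : (i <= d x y)%N -> P (c i) \/ Q (c i).
  by move=> ilen; apply: cover; exists i.
have ex : exists i, (i <= d x y)%N && `[< Q (c i) >].
  by exists (d x y); rewrite leqnn cn; apply/asboolP.
case: (ex_minnP ex) => -[|i] /andP[ilen /asboolP Qi] imin.
  rewrite c0 in Qi; exists x, x; split; rewrite ?word_distxx//;
    by exists 0%N.
exists (c i), (c i.+1); split.
- by exists i => //=; exact: ltnW.
- by exists i.+1.
- case: (cP i (ltnW ilen)) => // Qi'.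
  have : (i < i)%N by apply: imin; rewrite (ltnW ilen); exact/asboolP.
  by rewrite ltnn.
- exact: Qi.
- by rewrite cd ?(ltnW ilen)//; lia.
Qed.

Lemma gprod_le_dist w x y p :
  (d x p + d p y = d x y -> gprod S w x y <= 2 * d w p)%N.
Proof.
move=> xpy; have := word_dist_triangle S w p x.
have := word_dist_triangle S w p y.
by metric_lia.
Qed.

(** The Gromov product of [x] and [z] at [w] is, up to an error, the distance
from [w] to a geodesic [[x, z]]: in the triangle [w, x, z], some point [p] of
[[x, z]] is close to both other sides, and this [p] is almost nearest to [w].
In the triangle [x, y, z], [p] is close to [[x, y]] or to [[y, z]], so the
distance from [w] to one of these sides, hence one of the two other products, is
not much larger than the first. *)
Lemma hyperbolic_four_point : hyperbolic S -> exists E, four_point S E.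
Proof.
move=> [D thin]; exists (6 * D + 2)%N => w x y z.
have [A [sA Adist Ax Az Aconn]] := geodesic_side_exists x z.
have [B [sB Bdist Bz _ _]] := geodesic_side_exists z w.
have [C [sC Cdist _ Cx _]] := geodesic_side_exists w x.
have [AN _ _] := thin _ _ _ _ _ _ sA sB sC.
(* The point of the side [A] where its [C]-part meets its [B]-part. *)
have [p Ap pw] : exists2 p, A p & (2 * d w p <= gprod S w x z + 4 * D + 2)%N.
  have cover : A `<=` neighbourhood S D C `|` neighbourhood S D B.
    by move=> q /AN[q' [Bq'|Cq'] qq']; [right|left]; exists q'.
  have [||p [q [Ap Aq [p' /Cdist Cp' pp'] [q' /Bdist Bq' qq'] pq]]] :=
    Aconn _ _ cover.
  - by exists x => //; rewrite word_distxx.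
  - by exists z => //; rewrite word_distxx.
  exists p => //; have := Adist _ Ap; have := Adist _ Aq.
  have := word_dist_triangle S w p' p; have := word_dist_triangle S p p' x.
  have := word_dist_triangle S w q' q; have := word_dist_triangle S q q' z.
  have := word_dist_triangle S w q p; have := word_dist_triangle S p q z.
  by metric_lia.
have [B' [sB' Bdist' _ _ _]] := geodesic_side_exists z y.
have [C' [sC' Cdist' _ _ _]] := geodesic_side_exists y x.
have [/(_ _ Ap) + _ _] := thin _ _ _ _ _ _ sA sB' sC'.
move=> [q [/Bdist'|/Cdist'] qE pq];
  have := gprod_le_dist w qE; have := word_dist_triangle S w p q; metric_lia.
Qed.

Fixpoint word_ball n : {fset G} :=
  if n is n'.+1 then
    (word_ball n' `|` [fset g * s | g in word_ball n', s in generators S])%fset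
  else [fset 1]%fset.

Lemma word_ballP n g : (d 1 g <= n)%N -> g \in word_ball n.
Proof.
rewrite word_dist_sym; have /word_pathP[w [<- + ->]] := word_dist_path S g 1.
rewrite mul1g; elim/last_ind: w n => [|w s IH] n wS.
  move=> _; rewrite big_nil; elim: n => [|n IH] /=; first by rewrite inE.
  by rewrite inE IH.
rewrite size_rcons; case: n => //= n; rewrite ltnS => wn.
rewrite -cats1 big_cat big_seq1 /= inE; apply/orP; right.
apply/imfset2P; exists (\prod_(s <- w) s) => /=.
  by apply: IH => // t tw; apply: wS; rewrite mem_rcons inE tw orbT.
by exists s => //; apply: wS; rewrite mem_rcons inE eqxx.
Qed.

End Geodesics.

(** * Rays and their limits *)
Section Rays.
Variables (G : groupType) (S : sym_generating_set G).
Local Notation d := (word_dist S).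
Implicit Types g h u v w x y z : G.

Lemma ray_dist (c : nat -> G) i j :
  geodesic_ray S c -> (i <= j)%N -> d (c i) (c j) = (j - i)%N.
Proof. by move=> rc ij; rewrite rc; lia. Qed.

Variables (E : nat) (E4 : four_point S E).

(** Two rays whose points at late times have a large product stay together up to
that time: at [c 0], the pairs [(c k, c n)], [(c n, c' m)] and [(c' m, c' k)] all
have Gromov product about [k] or more, hence so does [(c k, c' k)]. *)
Lemma ray_fellow (c c' : nat -> G) K k n m :
  geodesic_ray S c -> geodesic_ray S c' -> (k <= n)%N -> (k <= m)%N ->
  (2 * k <= gprod S (c 0) (c n) (c' m) + K)%N ->
  (d (c k) (c' k) <= 3 * d (c 0) (c' 0) + 2 * E + K)%N.
Proof.
move=> rc rc' kn km prod.
have := E4 (c 0) (c k) (c n) (c' k); have := E4 (c 0) (c n) (c' m) (c' k).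
have := ray_dist rc (leq0n k); have := ray_dist rc (leq0n n).
have := ray_dist rc kn; have := ray_dist rc' km.
have := ray_dist rc' (leq0n k); have := ray_dist rc' (leq0n m).
have := word_dist_triangle S (c 0) (c' 0) (c' k).
have := word_dist_triangle S (c' 0) (c 0) (c' k).
have := word_dist_triangle S (c' 0) (c 0) (c' m).
have := word_dist_triangle S (c 0) (c' 0) (c' m).
metric_lia.
Qed.

Lemma gprod_base o u x y : (gprod S u x y <= gprod S o x y + 2 * d o u)%N.
Proof.
have := word_dist_triangle S u o x; have := word_dist_triangle S u o y.
metric_lia.
Qed.

End Rays.

Lemma ultra_finite_range (I : Type) (T : eqType) (U : set_system I)
    (f : I -> T) (s : seq T) :
  UltraFilter U -> U [set i | f i \in s] -> exists v, U [set i | f i = v].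
Proof.
move=> UU; elim: s => [|v s IH] Us.
  by have [i] := filter_ex Us.
have [Uv|Uv] := in_ultra_setVsetC [set i | f i = v] UU; first by exists v.
apply: IH; apply: filterS (filterI Us Uv) => i [/=].
by rewrite inE => /orP[/eqP|].
Qed.

(** Coordinatewise limit along a non-principal ultrafilter: each coordinate takes
finitely many values, so one of them is taken along the ultrafilter. *)
Lemma compact_sequences (T : eqType) (B : nat -> seq T) (f : nat -> nat -> T) :
  (forall n k, f n k \in B k) ->
  exists c : nat -> T, forall k N, exists2 n, (N <= n)%N &
    forall i, (i <= k)%N -> c i = f n i.
Proof.
move=> fB; have [U [UU ooU]] := @ultraFilterLemma nat \oo _.
have /choice[c cP] : forall k, exists v, U [set n | f n k = v].
  move=> k; apply: (@ultra_finite_range _ _ U (f^~ k) (B k)).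
  by apply: filterS filterT => n _; exact: fB.
exists c => k N.
suff: U [set n | (N <= n)%N /\ forall i, (i <= k)%N -> c i = f n i].
  by move=> /filter_ex[n [Nn cn]]; exists n.
apply: filterI; first by apply: ooU; exact: nbhs_infty_ge.
elim: k => [|k IH].
  by apply: filterS (cP 0%N) => n /= fn0 i; rewrite leqn0 => /eqP ->.
apply: filterS (filterI IH (cP k.+1)) => n [/= fk fk1] i.
by rewrite leq_eqVlt ltnS => /orP[/eqP-> //|/fk].
Qed.

Section Limits.
Variables (G : groupType) (S : sym_generating_set G).
Local Notation d := (word_dist S).

(** Convergence to a common boundary point. In particular [same_limit f f] says
that [f] converges to some boundary point. *)
Definition same_limit (f f' : nat -> G) := forall N, exists M, forall n m,
  (M <= n)%N -> (M <= m)%N -> (N <= gprod S 1 (f n) (f' m))%N.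

Lemma same_limit_base o f f' : (forall N, exists M, forall n m,
    (M <= n)%N -> (M <= m)%N -> (N <= gprod S o (f n) (f' m))%N) ->
  same_limit f f'.
Proof.
move=> ff' N; have [M MP] := ff' (N + 2 * d 1 o)%N; exists M => n m Mn Mm.
have := MP _ _ Mn Mm; have := @gprod_base _ S 1 o (f n) (f' m); metric_lia.
Qed.

Lemma same_limit_at o f f' N : same_limit f f' -> exists M, forall n m,
  (M <= n)%N -> (M <= m)%N -> (N <= gprod S o (f n) (f' m))%N.
Proof.
move=> ff'; have [M MP] := ff' (N + 2 * d 1 o)%N; exists M => n m Mn Mm.
have := MP _ _ Mn Mm; have := @gprod_base _ S o 1 (f n) (f' m); metric_lia.
Qed.

Variables (E : nat) (E4 : four_point S E).

Lemma same_limit_trans f f' f'' :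
  same_limit f f' -> same_limit f' f'' -> same_limit f f''.
Proof.
move=> ff' ff'' N; have [M MP] := ff' (N + E)%N.
have [M' MP'] := ff'' (N + E)%N; exists (M + M')%N => n m Mn Mm.
have := MP n (M + M')%N; have := MP' (M + M')%N m.
by have := E4 1 (f n) (f' (M + M')%N) (f'' m); lia.
Qed.

(** A limit of geodesics from [1] to the points [f n]. For [t] fixed, [c t] lies on
the geodesic to [f n] for some large [n], so their Gromov product at [1] is [t];
the four-point inequality extends this to all large indices. *)
Lemma limit_ray f : same_limit f f -> exists c,
  [/\ geodesic_ray S c, c 0 = 1 & same_limit c f].
Proof.
move=> ff; have /choice[c0 c0P] n := geodesic_exists S 1 (f n).
(* Beyond its end, the geodesic to [f n] is extended by an arbitrary point. *)
pose c1 n k := if (k <= d 1 (f n))%N then c0 n k else 1.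
have far N : exists M, forall n, (M <= n)%N -> (N <= d 1 (f n))%N.
  have [M MP] := ff (2 * N)%N; exists M => n Mn.
  by have := MP n n Mn Mn; metric_lia.
have [|c cP] := @compact_sequences G (fun k => word_ball S k) c1.
  move=> n k; apply: word_ballP; rewrite /c1; case: ifP => [kn|_].
    by have [c00 _ c0d] := c0P n; rewrite -{1}c00 c0d //; lia.
  by rewrite word_distxx.
have cP' k N : exists n, [/\ (N <= n)%N, (k <= d 1 (f n))%N &
    forall i, (i <= k)%N -> c i = c0 n i].
  have [M MP] := far k; have [n Nn cn] := cP k (N + M)%N.
  have kn : (k <= d 1 (f n))%N by apply: MP; lia.
  by exists n; split=> // [|i ik]; [lia | rewrite cn// /c1 (leq_trans ik kn)].
exists c; split.
- move=> i j; have [n [_ ijn cn]] := cP' (i + j)%N 0%N.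
  by rewrite !cn ?leq_addr ?leq_addl//; have [_ _ ->] := c0P n; lia.
- by have [n [_ _ ->//]] := cP' 0%N 0%N; have [] := c0P n.
move=> N; have [M MP] := ff (N + E)%N; exists (M + N + E)%N => t m Mt Mm.
have [n [Mn tn cn]] := cP' t M.
have := MP n m Mn; have := E4 1 (c t) (f n) (f m); rewrite cn//.
have [cn0 cnn cnd] := c0P n.
have := cnd 0%N t; have := cnd t (d 1 (f n)); rewrite cn0 cnn; metric_lia.
Qed.

Lemma ray_same_limit c : geodesic_ray S c -> same_limit c c.
Proof.
move=> rc; apply: (@same_limit_base (c 0)) => N; exists N => n m Nn Nm.
have := rc 0%N n; have := rc 0%N m; have := rc n m; metric_lia.
Qed.

Lemma same_limit_bound c c' k : geodesic_ray S c -> geodesic_ray S c' ->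
  same_limit c c' -> (d (c k) (c' k) <= 3 * d (c 0) (c' 0) + 2 * E)%N.
Proof.
move=> rc rc' /(same_limit_at (c 0) (2 * k))[M MP].
have := @ray_fellow _ _ _ E4 c c' 0 k (M + k) (M + k) rc rc'.
by rewrite !addn0; apply; rewrite ?leq_addl//; apply: MP; rewrite leq_addr.
Qed.

Lemma bounded_same_limit K c c' : geodesic_ray S c -> geodesic_ray S c' ->
  (forall k, (d (c k) (c' k) <= K)%N) -> same_limit c c'.
Proof.
move=> rc rc' cc'; apply: (@same_limit_base (c 0)) => N.
exists (N + K + d (c 0) (c' 0))%N => n m nN mN.
have := word_dist_triangle S (c n) (c m) (c' m); have := cc' m.
have := word_dist_triangle S (c 0) (c' m) (c m).
have := rc 0%N n; have := rc 0%N m; have := rc n m; metric_lia.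
Qed.

End Limits.

(** * Tracing a field of rays *)
Section Tracing.
Variables (G : groupType) (S : sym_generating_set G).
Local Notation d := (word_dist S).
Implicit Types a b g h u v w x y z : G.

Variables (E : nat) (E4 : four_point S E).
Variables (r : G -> nat -> G) (L T R K : nat).
Hypothesis r_ray : forall h, geodesic_ray S (r h).
Hypothesis r0 : forall h, r h 0 = h.
Hypothesis r_close : forall h h',
  (d h h' <= R)%N -> (d (r h T) (r h' T) <= K)%N.
Hypothesis L_large : (10 * E + 10 <= L)%N.
Hypothesis R_large : (2 * L + 5 * E + 3 <= R)%N.
Hypothesis T_large : (10 * L + K <= T)%N.

Definition step h := r h L.

Lemma dist_base_ray h n : d h (r h n) = n.
Proof. by rewrite -{1}(r0 h) (ray_dist (r_ray h)) ?subn0. Qed.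

Lemma dist_step h : d h (step h) = L.
Proof. exact: dist_base_ray. Qed.

Lemma dist_step_far h : d (step h) (r h T) = (T - L)%N.
Proof. by rewrite /step (ray_dist (r_ray h))//; lia. Qed.

(** The point [step (step u)] lies on the ray from [step u], hence near the ray
from [u], since both rays are close at time [T]. *)
Lemma step2_far u : (d (step (step u)) (r u T) + 2 * L <= T + E)%N.
Proof.
set v := step u; set w := step v.
have := E4 v w (r v T) (r u T).
have := dist_step u; have := dist_step v; have := dist_step_far u.
have := dist_step_far v; have := dist_base_ray v T; have := dist_base_ray u T.
have := r_close (h := u) (h' := v).
rewrite -/v -/w; have := word_dist_sym S u v; metric_lia.
Qed.

Lemma dist_step2 u : (2 * L <= d u (step (step u)) + E)%N.
Proof.
have := step2_far u; have := dist_base_ray u T.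
have := word_dist_triangle S u (step (step u)) (r u T); lia.
Qed.

(** At [iter n.+1 step u], the directions of the previous and of the next point
are nearly opposite by [dist_step2], and by induction [u] is in the direction of
the previous point. So [u] and the next point have a small product there. *)
Lemma dist_iterS u n :
  (d u (iter n step u) + L <= d u (iter n.+1 step u) + 2 * E)%N.
Proof.
elim: n => [|n IH] /=; first by rewrite word_distxx dist_step; lia.
move: IH => /=; set x := iter n step u; set v := step x; set w := step v.
have := E4 v w u x; have := dist_step x; have := dist_step v.
have := dist_step2 x; rewrite -/v -/w; metric_lia.
Qed.

(** The mirror image of [dist_iterS]. *)
Lemma dist_iterSr u n :
  (d (step u) (iter n step (step u)) + L
     <= d u (iter n step (step u)) + 2 * E)%N.
Proof.
elim: n u => [|n IH] u /=; first by rewrite word_distxx dist_step; lia.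
rewrite -iterS iterSr; move: (IH (step u)).
set v := step u; set w := step v; set x := iter n step w.
have := E4 v u x w; have := dist_step u; have := dist_step v.
have := dist_step2 u; rewrite -/v -/w; metric_lia.
Qed.

(** Every point of the sequence is nearly on a geodesic between an earlier and a
later one: seen from it, the earlier one is opposite to the next point
([dist_iterS]) while the later one is in its direction ([dist_iterSr]). *)
Lemma dist_iterD u n k :
  (d u (iter n step u) + d (iter n step u) (iter k step (iter n step u))
     <= d u (iter k step (iter n step u)) + 3 * E)%N.
Proof.
have /= := dist_iterS u n; set v := iter n step u; set w := step v.
case: k => [|k]; first by rewrite /= word_distxx; lia.
rewrite iterSr -/w; have := dist_iterSr v k; rewrite -/w.
set x := iter k step w.
have := dist_step v; rewrite -/w; have := E4 v u x w; metric_lia.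
Qed.

Lemma dist_far u n :
  (d u (iter n step u) + T <= d u (r (iter n step u) T) + 3 * E)%N.
Proof.
have /= := dist_iterS u n; set v := iter n step u; set w := step v.
have := dist_step v; have := dist_step_far v; have := dist_base_ray v T.
have := E4 v u (r v T) w; rewrite -/w; metric_lia.
Qed.

(** The points at least two steps after [v = iter n step u] are, seen from [u], in
the direction of the end of the ray chosen at [v], up to about two steps beyond
[v]. Two steps are needed: one step does not reach past the place of separation
in [gprod_neighbours]. *)
Lemma gprod_iter_far u n k : (2 <= k)%N ->
  (2 * d u (iter n step u) + 4 * L
     <= gprod S u (iter (k + n) step u) (r (iter n step u) T) + 11 * E)%N.
Proof.
move=> k2; rewrite -{1}(subnK k2) addn2 iterD !iterSr.
have /= := dist_iterD u n.+2 (k - 2); move: (k - 2)%N => {k2}k.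
have /= := dist_iterD u n 2.
have := dist_far u n; set v := iter n step u; set z := step (step v).
have := step2_far v; have := dist_step2 v; rewrite -/z; set x := iter k step z.
have := word_dist_triangle S x z (r v T); metric_lia.
Qed.

Lemma dist_iter_ge u n : (n <= d u (iter n step u))%N.
Proof. by elim: n => // n IH; have := dist_iterS u n; lia. Qed.

(** Two steps must follow the last point at distance at most [t / 2] from [u] for
[gprod_iter_far] to apply there; if fewer do, the sequence ends at most one
step beyond this distance. *)
Lemma dist_iter_cross u t n : (2 * d u (iter n step u) <= t + 2 * L)%N \/
  exists i k, [/\ n = (k + i)%N, (2 <= k)%N, (2 * d u (iter i step u) <= t)%N
    & (t < 2 * d u (iter i step u) + 2 * L)%N].
Proof.
suff: (2 * d u (iter n step u) <= t)%N \/
  exists i k, [/\ n = (k + i)%N, (1 <= k)%N, (2 * d u (iter i step u) <= t)%N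
    & (t < 2 * d u (iter i step u) + 2 * L)%N].
  case=> [le|[i [[|[|k]] [nE // _ le lt]]]]; first by left; lia.
    left; move: nE => ->; rewrite add1n /=.
    have := dist_step (iter i step u).
    have := word_dist_triangle S u (iter i step u) (step (iter i step u)); lia.
  by right; exists i, k.+2.
elim: n => [|n [le|[i [k [-> k1 le lt]]]]]; first by left;
    rewrite /= word_distxx.
  case: (leqP (2 * d u (iter n.+1 step u)) t) => [|lt]; first by left.
  right; exists n, 1%N; split=> //.
  move: lt; rewrite iterS; have := dist_step (iter n step u).
  have := word_dist_triangle S u (iter n step u) (step (iter n step u)); lia.
by right; exists i, k.+1; split=> //; lia.
Qed.

(** Suppose that [t = gprod S a x y] violates the inequality. The last points [a'] and [b'] at distance at most [t / 2] from [a] and [b] are within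
[R] of each other, so the ends of the rays chosen there have a [gprod] far above
[t]. With the end of the corresponding ray, each of [x] and [y] has a [gprod] of
at least [t + 2 * L] up to an error, by [gprod_iter_far]; that of [x] and [y]
would then exceed [t]. *)
Lemma gprod_neighbours a b n m : (d a b <= 1)%N ->
  (2 * minn (d a (iter n step a)) (d b (iter m step b))
     <= gprod S a (iter n step a) (iter m step b) + 2 * L)%N.
Proof.
set x := iter n step a; set y := iter m step b => ab.
case: (dist_iter_cross a (gprod S a x y) n) => [|[i [k [nE k2 le lt]]]].
  by rewrite -/x; lia.
case: (dist_iter_cross b (gprod S a x y) m) => [|[j [l [mE l2 le' lt']]]].
  by rewrite -/y; lia.
exfalso.
have := gprod_iter_far a i k2; have := gprod_iter_far b j l2.
have := dist_iterD a i k; have := dist_iterD b j l.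
have := dist_far a i; have := dist_far b j.
rewrite -!iterD -nE -mE -/x -/y; move: le lt le' lt'.
set a' := iter i step a; set b' := iter j step b.
move=> le lt le' lt' far_b far_a split_b split_a prod_b prod_a.
have tri := word_dist_triangle S b a; have tri' := word_dist_triangle S a b.
have ba := word_dist_sym S a b.
have close : (d a' b' <= R)%N.
  have := E4 a a' x b'; have := E4 a x y b'.
  have := tri b'; have := tri' b'; have := tri y; have := tri' y; metric_lia.
have := r_close close; have := E4 a x (r a' T) y.
have := E4 a (r a' T) (r b' T) y.
have := tri (r b' T); have := tri' (r b' T); have := tri y; have := tri' y.
have := dist_base_ray a' T; have := dist_base_ray b' T.
have := word_dist_triangle S a a' (r a' T).
have := word_dist_triangle S b b' (r b' T).
metric_lia.
Qed.

Let path_from h n := iter n step h.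

Lemma same_limit_neighbours a b :
  (d a b <= 1)%N -> same_limit S (path_from a) (path_from b).
Proof.
move=> ab; apply: (@same_limit_base _ _ a) => N; exists (N + L)%N => n m nN mN.
have := gprod_neighbours n m ab.
have := dist_iter_ge a n.
have := dist_iter_ge b m.
by rewrite -/(path_from a n) -/(path_from b m); lia.
Qed.

Lemma same_limit_all h : same_limit S (path_from 1) (path_from h).
Proof.
have [w wS ->] := generators_gen S h; elim/last_ind: w wS => [|w s IH] wS.
  by rewrite big_nil; apply: same_limit_neighbours; rewrite word_distxx.
apply: (same_limit_trans E4 (IH _)) => [t tw|].
  by apply: wS; rewrite mem_rcons inE tw orbT.
apply: same_limit_neighbours; rewrite word_dist_sym.
apply: word_dist_min; apply/word_pathP; exists [:: s]; split=> //.
  by move=> t; rewrite inE => /eqP ->; apply: wS; rewrite mem_rcons inE eqxx.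
by rewrite -cats1 big_cat.
Qed.

(** The common limit of all sequences is seen from [h] in the direction of
[iter m step h], hence of the end of [r h]. *)
Lemma tracing_ray : exists c, [/\ geodesic_ray S c, c 0 = 1 &
  forall h, exists M, forall t, (M <= t)%N ->
    (4 * L <= gprod S h (c t) (r h T) + 12 * E)%N].
Proof.
have [c [rc c0 cf]] := limit_ray E4 (same_limit_all 1).
exists c; split=> // h.
have [M MP] :=
  same_limit_at h (4 * L) (same_limit_trans E4 cf (same_limit_all h)).
exists (M + 2)%N => t Mt; have M2 : (2 <= M + 2)%N by lia.
have := gprod_iter_far h 0 M2.
have := MP t (M + 2)%N; rewrite /= addn0 -/(path_from h (M + 2)).
by have := E4 h (c t) (path_from h (M + 2)) (r h T); metric_lia.
Qed.

End Tracing.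

(** * The topology of the boundary *)
Section BoundaryTopology.
Variables (G : groupType) (S : sym_generating_set G).
Local Notation d := (word_dist S).
Implicit Types (c : ray_space S) (xi : boundary S).

Lemma ray_funP c : geodesic_ray S (ray_fun c).
Proof. exact: (set_mem (valP c)). Qed.

Definition ray_of (f : nat -> G) (rf : geodesic_ray S f) : ray_space S :=
  exist (fun f => f \in ray_set S) f (mem_set rf).

Lemma ray_translateE g c t : ray_fun (ray_translate g c) t = g * ray_fun c t.
Proof. by []. Qed.

Let ray_fun_continuous : continuous
  (@ray_fun G S : _ -> {family bounded_nat, nat -> discrete_topology G}).
Proof. exact: initial_continuous. Qed.

(** The rays that agree with [c] up to time [n], for varying [n], generate a filter
that converges to [c] uniformly on bounded sets. *)
Lemma open_ray_prefix (A : set (ray_space S)) c : open A -> A c ->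
  exists n, forall c',
    (forall i, (i <= n)%N -> ray_fun c' i = ray_fun c i) -> A c'.
Proof.
move=> [B oB <-] Bc.
pose P n := [set f : {family bounded_nat, nat -> discrete_topology G} |
  forall i, (i <= n)%N -> f i = ray_fun c i].
pose F := filter_from setT P.
have FF : Filter F.
  apply: filter_from_filter; first by exists 0%N.
  move=> m n _ _; exists (m + n)%N => // f fP; split=> i ij;
    by apply: fP; rewrite (leq_trans ij)// ?leq_addr ?leq_addl.
have : F --> (ray_fun c : {family bounded_nat, nat -> discrete_topology G}).
  apply/(fam_cvgP _ _ FF) => I [n In] Q /uniform_nbhs[D [entD DQ]].
  exists n => // f fP; apply: DQ => i /In /= /fP ->; exact: entourage_refl.
move=> /(_ B (open_nbhs_nbhs (conj oB Bc)))[n _ PB].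
by exists n => c' cc'; apply: PB.
Qed.

Lemma prefix_open_ray (A : set (ray_space S)) :
  (forall c, A c -> exists n, forall c',
    (forall i, (i <= n)%N -> ray_fun c' i = ray_fun c i) -> A c') -> open A.
Proof.
move=> AP; rewrite openE => c Ac; have [n nP] := AP c Ac.
have entD : entourage (range (fun x : discrete_topology G => (x, x))).
  by rewrite uniform_discrete.
have bn : bounded_nat [set i | (i <= n)%N] by exists n.
have /= cn := @ray_fun_continuous c _ (fam_nbhs _ entD bn).
apply: (@filterS _ _ (nbhs_filter c) _ _ _ cn) => c' cc'; apply: nP => i ni.
by have [x _ [<- <-]] := cc' i ni.
Qed.

Variables (E : nat) (E4 : four_point S E).

Lemma asymptoticP c c' :
  asymptotic c c' <-> same_limit S (ray_fun c) (ray_fun c').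
Proof.
split=> [[r [cc' _]]|cc'].
  pose D := d (ray_fun c 0) (ray_fun c' 0).
  apply: (@bounded_same_limit _ _ (2 * r + D)); try exact: ray_funP.
  move=> k; have [|_ [j _ <-] kj] := cc' (ray_fun c k); first by exists k.
  have := ray_funP c 0%N k; have := ray_funP c' 0%N j; have := ray_funP c' j k.
  have := word_dist_triangle S (ray_fun c k) (ray_fun c' j) (ray_fun c' k).
  have := word_dist_triangle S (ray_fun c 0) (ray_fun c' 0) (ray_fun c k).
  have := word_dist_triangle S (ray_fun c 0) (ray_fun c k) (ray_fun c' j).
  have := word_dist_triangle S (ray_fun c' 0) (ray_fun c 0) (ray_fun c' j).
  have := word_dist_triangle S (ray_fun c' 0) (ray_fun c' j) (ray_fun c k).
  by rewrite /D; metric_lia.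
have bound k := same_limit_bound E4 k (ray_funP c) (ray_funP c') cc'.
exists (3 * d (ray_fun c 0) (ray_fun c' 0) + 2 * E)%N.
split=> _ [k _ <-]; first by exists (ray_fun c' k); [exists k | exact: bound].
by exists (ray_fun c k); [exists k | rewrite word_dist_sym; exact: bound].
Qed.

Lemma asymptotic_bound c c' k : asymptotic c c' ->
  (d (ray_fun c k) (ray_fun c' k)
     <= 3 * d (ray_fun c 0) (ray_fun c' 0) + 2 * E)%N.
Proof.
by move=> /asymptoticP/same_limit_bound; apply => //; exact: ray_funP.
Qed.

Lemma based_ray xi : exists2 c, ray_fun c 0 = 1 & ray_class c = xi.
Proof.
have [c ->] := ray_class_surj xi.
have [f [rf f0 fc]] := limit_ray E4 (ray_same_limit (ray_funP c)).
by exists (ray_of rf) => //; apply/ray_classP/asymptoticP.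
Qed.

Lemma based_ray_ball c k : ray_fun c 0 = 1 -> ray_fun c k \in word_ball S k.
Proof.
move=> c0; apply: word_ballP; rewrite -c0 (ray_dist (ray_funP c))//.
by rewrite subn0.
Qed.

Lemma based_rays_compact (c : nat -> ray_space S) :
  (forall n, ray_fun (c n) 0 = 1) ->
  exists c', forall k N, exists2 n, (N <= n)%N &
    forall i, (i <= k)%N -> ray_fun c' i = ray_fun (c n) i.
Proof.
move=> c0; have [n k|f fP] := @compact_sequences G (word_ball S)
    (fun n => ray_fun (c n)).
  exact: based_ray_ball.
suff rf : geodesic_ray S f by exists (ray_of rf).
move=> i j; have [n _ cn] := fP (i + j)%N 0%N.
by rewrite !cn ?leq_addr ?leq_addl//; exact: ray_funP.
Qed.

(** The quantification over all rays from [1] to [xi] is what makes shadows open: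
a point is outside as soon as one ray violates the bound at time [n], and such
rays pass to the limit. *)
Definition shadow n v : set (boundary S) :=
  [set xi | forall c, ray_fun c 0 = 1 -> ray_class c = xi ->
    (d (ray_fun c n) v <= 2 * E)%N].

(** Otherwise some point of the shadow is the end of a ray [c], approximated by
rays [cc.1] whose ends, also reached by rays [cc.2] from [1], are not in the
shadow. A limit of the rays [cc.2] has the same end as [c], because asymptotic
rays are at bounded distance, with a bound that depends only on their origins;
and this limit violates the condition at time [n]. *)
Lemma open_shadow n v : open (shadow n v).
Proof.
rewrite /open /= /quotient_open; apply: prefix_open_ray => c shc.
apply: contrapT => nex.
have /choice[cc ccP] k : exists cc : ray_space S * ray_space S,
    [/\ forall i, (i <= k)%N -> ray_fun cc.1 i = ray_fun c i,
        ray_fun cc.2 0 = 1, ray_class cc.2 = ray_class cc.1 &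
        ~ (d (ray_fun cc.2 n) v <= 2 * E)%N].
  apply: contrapT => nc; apply: nex; exists k => c1 c1c c2 c20 c2c1.
  by apply: contrapT => far; apply: nc; exists (c1, c2).
have [|c' c'P] := @based_rays_compact (snd \o cc).
  by move=> k; have [] := ccP k.
have c'0 : ray_fun c' 0 = 1.
  by have [k _ ->//] := c'P 0%N 0%N; have [] := ccP k.
suff c'c : ray_class c' = ray_class c.
  have [k _ c'k] := c'P n 0%N; have [_ _ _] := ccP k; apply.
  by rewrite -c'k//; exact: shc.
apply/ray_classP/asymptoticP.
apply: (@bounded_same_limit _ _ (3 * d 1 (ray_fun c 0) + 2 * E));
  try exact: ray_funP.
move=> k; have [m km c'm] := c'P k k; have [cm c20 /ray_classP c21 _] := ccP m.
by have := asymptotic_bound k c21; rewrite c'm//= c20 !cm.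
Qed.

(** The constant [2 * E] is the distance that asymptotic rays from [1] can have. *)
Lemma cover_shadow n xi : exists2 v, v \in word_ball S n & shadow n v xi.
Proof.
have [c c0 cxi] := based_ray xi; exists (ray_fun c n).
  exact: based_ray_ball.
move=> c' c'0 c'xi; have /ray_classP cc' : ray_class c' = ray_class c.
  by rewrite c'xi.
by have := asymptotic_bound n cc'; rewrite c0 c'0 word_distxx.
Qed.

Lemma finite_shadow_cover n : exists m (v : 'I_m -> G),
  finite_open_cover (fun j => shadow n (v j)).
Proof.
exists (size (word_ball S n)), (fun j => nth 1 (word_ball S n) j).
split=> [j|]; first exact: open_shadow.
apply/seteqP; split=> // xi _; have [v vB vxi] := cover_shadow n xi.
have vs : (index v (word_ball S n) < size (word_ball S n))%N.
  by rewrite index_mem.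
by exists (Ordinal vs) => //=; rewrite nth_index.
Qed.

(** Otherwise two sequences of rays that are close up to later and later times have
ends with no common [U i]. Their limits are asymptotic, so a single [U i] contains
the ends of both limits, and then, being open, the ends of rays far out in the two
sequences. *)
Lemma lebesgue_number m (U : 'I_m -> set (boundary S)) K :
  finite_open_cover U ->
  exists n, forall c c', ray_fun c 0 = 1 -> ray_fun c' 0 = 1 ->
    (d (ray_fun c n) (ray_fun c' n) <= K)%N ->
    exists i, U i (ray_class c) /\ U i (ray_class c').
Proof.
move=> [oU cU]; apply: contrapT => nex.
have /choice[cc ccP] n : exists cc : ray_space S * ray_space S,
    [/\ ray_fun cc.1 0 = 1, ray_fun cc.2 0 = 1,
        (d (ray_fun cc.1 n) (ray_fun cc.2 n) <= K)%N &
        ~ exists i, U i (ray_class cc.1) /\ U i (ray_class cc.2)].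
  apply: contrapT => nc; apply: nex; exists n => c1 c2 c10 c20 c12.
  by apply: contrapT => nU; apply: nc; exists (c1, c2).
have [|c1 c1P] := @based_rays_compact (fst \o cc).
  by move=> n; have [] := ccP n.
(* The second rays converge along a subsequence [s] of the first one. *)
have /choice[s sP] n : exists m, (n <= m)%N /\
  forall i, (i <= n)%N -> ray_fun c1 i = ray_fun (cc m).1 i.
  by have [k nk] := c1P n n; exists k.
have [|c2 c2P] := @based_rays_compact (fun n => (cc (s n)).2).
  by move=> n; have [] := ccP (s n).
have both k : exists n, [/\ (k <= n)%N,
    forall i, (i <= k)%N -> ray_fun (cc n).1 i = ray_fun c1 i &
    forall i, (i <= k)%N -> ray_fun (cc n).2 i = ray_fun c2 i].
  have [n kn c2n] := c2P k k; have [sn c1n] := sP n.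
  exists (s n); split=> [|i ik|i ik]; [exact: leq_trans sn| |by rewrite c2n].
  by rewrite c1n// (leq_trans ik).
have c12 : ray_class c1 = ray_class c2.
  apply/ray_classP/asymptoticP.
  apply: (@bounded_same_limit _ _ (2 * E + K)); try exact: ray_funP.
  move=> k; have [n [kn n1 n2]] := both k; have [n10 n20 near _] := ccP n.
  rewrite -n1// -n2//.
  have := @ray_fellow _ _ _ E4 _ _ K k n n
    (ray_funP (cc n).1) (ray_funP (cc n).2) kn kn.
  rewrite n10 n20 word_distxx; apply.
  have := ray_funP (cc n).1 0%N n; have := ray_funP (cc n).2 0%N n.
  by rewrite n10 n20; metric_lia.
have [i _ Ui] : cover setT U (ray_class c1) by rewrite cU.
have [k1 k1P] := open_ray_prefix (oU i) Ui.
have Ui2 : U i (ray_class c2) by rewrite -c12.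
have [k2 k2P] := open_ray_prefix (oU i) Ui2.
have [n [_ n1 n2]] := both (k1 + k2)%N; have [_ _ _] := ccP n; apply.
exists i; split; [apply: k1P|apply: k2P] => j jk.
  by apply: n1; rewrite (leq_trans jk) ?leq_addr.
by apply: n2; rewrite (leq_trans jk) ?leq_addl.
Qed.

End BoundaryTopology.

Theorem theorem1p1 (G : groupType) (S : sym_generating_set G)
    (hypG : hyperbolic S) :
  shadowing (boundary_action S).
Proof.
have [E E4] := hyperbolic_four_point hypG.
move=> m U /(@lebesgue_number _ _ _ E4 _ _ (2 * E))[M MP].
(* [M] makes the tracing precise enough for the Lebesgue number; [K] bounds how far
   the rays at vertices [R] apart are at time [T], by two shadows of radius
   [2 * E] and [asymptotic_bound]. *)
pose L := (10 * E + 10 + M)%N; pose R := (2 * L + 5 * E + 3)%N.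
pose K := (3 * R + 6 * E)%N; pose T := (10 * L + K)%N.
have [n [v vP]] := finite_shadow_cover E4 T.
exists n, (fun j => shadow E T (v j)); split=> //.
exists (word_ball S R) => x pseudo.
have /choice[rho rhoP] g : exists c : ray_space S,
    ray_fun c 0 = 1 /\ ray_class c = x g.
  by have [c] := based_ray E4 (x g); exists c.
(* The ray from [h] to the boundary point [h x_(h^-1)]. *)
pose r h t := h * ray_fun (rho h^-1) t.
have r0 h : r h 0 = h by have [rho0 _] := rhoP h^-1; rewrite /r rho0 mulg1.
have r_ray h : geodesic_ray S (r h).
  by move=> i j; rewrite word_distM; exact: ray_funP.
have r_close h h' : (word_dist S h h' <= R)%N ->
    (word_dist S (r h T) (r h' T) <= K)%N.
  move=> hh'; pose s := h'^-1 * h.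
  have sR : (word_dist S 1 s <= R)%N.
    by rewrite -(word_distM S h') mulg1 /s mulVKg word_dist_sym.
  have [j [Vs Vx]] := pseudo h^-1 s (word_ballP sR).
  have sh : s * h^-1 = h'^-1 by rewrite /s mulgK.
  move: Vx; rewrite sh => Vx.
  have [rho0 rhoE] := rhoP h^-1; have [rho0' rhoE'] := rhoP h'^-1.
  have near' := Vx _ rho0' rhoE'.
  have [c c0 cE] := based_ray E4 (boundary_action S s (x h^-1)).
  have near := Vs _ c0 cE.
  have /ray_classP cs : ray_class c = ray_class (ray_translate s (rho h^-1)).
    by rewrite cE -boundary_translateE rhoE.
  have := asymptotic_bound E4 T cs.
  rewrite c0 (ray_translateE _ _ 0) rho0 mulg1.
  set q := ray_fun (ray_translate s _) T => close.
  have -> : r h T = h' * q.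
    by rewrite /r /q ray_translateE /s !mulgA mulgV mul1g.
  rewrite word_distM.
  have := word_dist_triangle S q (v j) (ray_fun (rho h'^-1) T).
  have := word_dist_triangle S q (ray_fun c T) (v j).
  rewrite /K; metric_lia.
have L_large : (10 * E + 10 <= L)%N by rewrite /L leq_addr.
have [c [rc c0 cP]] :=
  tracing_ray E4 r_ray r0 r_close L_large (leqnn R) (leqnn T).
exists (ray_class (ray_of rc)) => g.
have [e e0 eE] := based_ray E4 (boundary_action S g (ray_class (ray_of rc))).
have [rho0 <-] := rhoP g; rewrite -eE; apply: MP => //.
have /ray_classP/(asymptoticP E4) eg :
    ray_class e = ray_class (ray_translate g (ray_of rc)).
  by rewrite eE -boundary_translateE.
(* Seen from [1], the end of [e] is close to [g * c t] for large [t], hence to the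
   end of [rho g], which is [g] times the end of the ray from [g^-1]. *)
have [N NP] := same_limit_at 1 (2 * M + E) eg.
have [N' NP'] := cP g^-1.
pose t := (M + N + N')%N.
have := @ray_fellow _ _ _ E4 _ _ 0 M t T (ray_funP e) (ray_funP (rho g)).
rewrite e0 rho0 word_distxx !addn0; apply; try by rewrite /t /T /L; lia.
have := NP t t; have := NP' t.
rewrite /r invgK; set q := ray_fun (ray_translate g _) t.
have -> : gprod S g^-1 (c t) (g^-1 * ray_fun (rho g) T) =
          gprod S 1 q (ray_fun (rho g) T).
  by rewrite -(gprodM S g) mulgV mulVKg.
have := E4 1 (ray_fun e t) q (ray_fun (rho g) T).
rewrite /t /L; metric_lia.
Qed.
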